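(* Let $V$ be a finite set of variables, let $g$ be a term with $\hat g\subseteq V$, and let $Call=((cl_1,sh_1),f_1)$ and $Prime=((cl_2,sh_2),f_2)$ be elements of $SHF^{w}$ such that every set occurring in $cl_1\cup sh_1$ is a subset of $V$ and $f_1\subseteq V$, every set occurring in $cl_2\cup sh_2$ is a subset of $\hat g$ and $f_2\subseteq\hat g$, and $(cl_2,sh_2)$ is normalized. Let $extend^{sf}(Call,g,Prime)=((cl',sh'),f')$. Let $s_1=\downarrow\!\!(cl_1)\cup sh_1$, $s_2=\downarrow\!\!(cl_2)\cup sh_2$, and $extend^f((s_1,f_1),g,(s_2,f_2))=(sh,f)$. Then \[ \downarrow\!\!(cl')\cup sh'\supseteq sh \quad\text{and}\quad f'\subseteq f. \]
   Context: For a set $S$, $\wp^0(S)$ denotes the set of nonempty subsets of $S$. Variables of interest form a finite set $V$; for a term (or atom) $t$, $\hat t$ denotes its set of variables. A sharing group is a nonempty subset of $V$; a sharing set is a set of sharing groups. A clique is a nonempty subset $C\subseteq V$, standing for all groups in $\wp^0(C)$; a clique set $cl$ is a set of cliques, and $\downarrow\!\!(cl):=\bigcup_{C\in cl}\wp^0(C)$. $SH^{w}$ consists of pairs $(cl,sh)$ of a clique set and a sharing set (representing the sharing set $\downarrow\!\!(cl)\cup sh$); $SHF^{w}$ consists of triples $((cl,sh),f)$ with $(cl,sh)\in SH^w$ and $f\subseteq V$ (the variables known to be free). Operations on a set $s$ of sets of variables: $s_1\uplus s_2=\{A\cup B\mid A\in s_1,B\in s_2\}$; $s^*$ is the closure of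 $s$ under (nonempty finite) unions; for a term $t$, $s_t=\{A\in s\mid A\cap\hat t\neq\emptyset\}$ and $\overline{s_t}=s\setminus s_t$; for a variable $x$, $s_x=\{A\in s\mid x\in A\}$; $\bigcup s$ is the union of the members of $s$. For $S\subseteq V$ and a clique set $cl$, $\overline{rel}(S,cl)=\{C\setminus S\mid C\in cl\}\setminus\{\emptyset\}$. A pair $(cl,sh)$ is normalized if whenever $s\subseteq\downarrow\!\!(cl)\cup sh$ with $s=\wp^0(c)$ for some set $c$, then $s\cap sh=\emptyset$. $normalize$ denotes a function mapping a pair $(cl,sh)$ to a normalized pair $(cl'',sh'')$ with $\downarrow\!\!(cl'')\cup sh''=\downarrow\!\!(cl)\cup sh$. Classical extend on sharing sets: $extend(Call,g,Prime)=\overline{Call_g}\cup\{s\mid s\in Call_g^*,\ (s\cap\hat g)\in Prime\}$. Sharing+Freeness extend: $extend^f((sh_1,f_1),g,(sh_2,f_2))=(sh^\dagger,f^\dagger)$ with $sh^\dagger=extend(sh_1,g,sh_2)$ and $f^\dagger=f_2\cup\{x\mid x\in f_1\setminus\hat g,\ ((\bigcup sh^\dagger_x)\cap\hat g)\subseteq f_2\}$. Clique extend: given $(cl_1,sh_1)$, $(cl_2,sh_2)$, let $(cl^\circ,sh^\circ)=normalize\big(({cl_1}_g)^*\cup(({cl_1}_g)^*\uplus({sh_1}_g)^* ),\ ({sh_1}_g)^*\big)$ and $extsh=\overline{{sh_1}_g}\cup\{s\in sh^\circ\mid (s\cap\hat g)\in sh_2\}$; $extcl=\overline{rel}(\hat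 g,cl_1)\cup\{(s'\cap s)\cup(s'\setminus\hat g)\mid s'\in cl^\circ,\ s\in cl_2\}$; $clsh=\{s\mid s\subseteq c\text{ for some }c\in cl^\circ,\ (s\cap\hat g)\in sh_2\}$; $shcl=\{s\in sh^\circ\mid (s\cap\hat g)\subseteq c\text{ for some }c\in cl_2\}$; $extend^s((cl_1,sh_1),g,(cl_2,sh_2))=(extcl,\ extsh\cup clsh\cup shcl)$. Then $extend^{sf}(((cl_1,sh_1),f_1),g,((cl_2,sh_2),f_2))=((cl',sh'),f')$ where $(cl',sh')=extend^s((cl_1,sh_1),g,(cl_2,sh_2))$ and $f'=f_2\cup\{x\mid x\in f_1\setminus\hat g,\ (\bigcup(sh'_x\cup cl'_x))\cap\hat g\subseteq f_2\}$. *)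

(* Defs.v *)
From mathcomp Require Import all_boot.

Set Implicit Arguments.
Unset Strict Implicit.
Unset Printing Implicit Defensive.

(* First-order terms over function symbols F and variables X. An atom has the
   same shape, its predicate symbol being taken in F. *)
Inductive term (F X : Type) : Type :=
| Var of X
| App of F & seq (term F X).

Fixpoint vars (F : Type) (V : finType) (t : term F V) : {set V} :=
  match t with
  | Var x => [set x]
  | App _ ts => foldr (fun u acc => vars u :|: acc) set0 ts
  end.

(* The finite set of variables of interest is the finType V, so being a set of
   variables of interest is enforced by typing. *)
Section Domain.
Variable V : finType.

Definition groups := {set {set V}}.

Definition pow0 (S : {set V}) : groups := [set A in powerset S | A != set0].

Definition down (cl : groups) : groups := \bigcup_(C in cl) pow0 C.

(* Both clique sets and sharing sets are sets of nonempty sets of variables. *)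
Definition is_SHw (p : groups * groups) : Prop :=
  set0 \notin p.1 /\ set0 \notin p.2.

Definition denot (p : groups * groups) : groups := down p.1 :|: p.2.

Definition normalized (p : groups * groups) : Prop :=
  forall (s : groups) (c : {set V}),
    s \subset denot p -> s = pow0 c -> s :&: p.2 = set0.

Definition is_normalize (normalize : groups * groups -> groups * groups) : Prop :=
  forall p, is_SHw p ->
    [/\ is_SHw (normalize p), normalized (normalize p)
      & denot (normalize p) = denot p].

Definition bin_union (s1 s2 : groups) : groups :=
  [set A :|: B | A in s1, B in s2].

(* All unions of nonempty subfamilies of s; subfamilies are finite since V is. *)
Definition star (s : groups) : groups :=
  [set cover t | t in [set t in powerset s | t != set0]].

Definition rel_vars (s : groups) (S : {set V}) : groups :=
  [set A in s | A :&: S != set0].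

Definition irrel_vars (s : groups) (S : {set V}) : groups :=
  s :\: rel_vars s S.

Definition rel_var (s : groups) (x : V) : groups := [set A in s | x \in A].

Definition rel_bar (S : {set V}) (cl : groups) : groups :=
  [set C :\: S | C in cl] :\ set0.

End Domain.

Section Extend.
Variables (F : Type) (V : finType).
Implicit Types (g : term F V) (call prime : groups V).

Definition extend call g prime : groups V :=
  irrel_vars call (vars g)
  :|: [set s in star (rel_vars call (vars g)) | s :&: vars g \in prime].

Definition extend_f (Call : groups V * {set V}) g (Prime : groups V * {set V})
    : groups V * {set V} :=
  let: (sh1, f1) := Call in
  let: (sh2, f2) := Prime in
  let sh := extend sh1 g sh2 in
  (sh, f2 :|: [set x in f1 :\: vars g |
                (cover (rel_var sh x) :&: vars g) \subset f2]).

Variable normalize : groups V * groups V -> groups V * groups V.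

Definition extend_s (Call : groups V * groups V) g
    (Prime : groups V * groups V) : groups V * groups V :=
  let: (cl1, sh1) := Call in
  let: (cl2, sh2) := Prime in
  let cl1g := star (rel_vars cl1 (vars g)) in
  let sh1g := star (rel_vars sh1 (vars g)) in
  let: (clo, sho) := normalize (cl1g :|: bin_union cl1g sh1g, sh1g) in
  let extsh := irrel_vars sh1 (vars g)
               :|: [set s in sho | s :&: vars g \in sh2] in
  let extcl := rel_bar (vars g) cl1
               :|: [set (s' :&: s) :|: (s' :\: vars g) | s' in clo, s in cl2] in
  let clsh := [set s : {set V} | [exists c in clo, s \subset c]
                                 && (s :&: vars g \in sh2)] in
  let shcl := [set s in sho | [exists c in cl2, (s :&: vars g) \subset c]] in
  (extcl, extsh :|: clsh :|: shcl).

Definition extend_sf (Call : (groups V * groups V) * {set V}) g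
    (Prime : (groups V * groups V) * {set V})
    : (groups V * groups V) * {set V} :=
  let: (p1, f1) := Call in
  let: (p2, f2) := Prime in
  let: (cl', sh') := extend_s p1 g p2 in
  ((cl', sh'),
   f2 :|: [set x in f1 :\: vars g |
            (cover (rel_var sh' x :|: rel_var cl' x) :&: vars g) \subset f2]).

End Extend.

(* Main.v *)
(* A group of the classical result is a union of groups relevant to g, each of
   which is in sh1 or below a clique of cl1. Replacing the latter by those
   cliques shows that the union is represented by the argument of normalize,
   hence by (clo, sho). Whether it is represented by clo or by sho, and its
   trace on g by cl2 or by sh2, are the four cases covered by the four
   components of extend_s. Freeness is antitone in the sharing information. *)

Require Import Defs.
From mathcomp Require Import all_boot.

Set Implicit Arguments.
Unset Strict Implicit.
Unset Printing Implicit Defensive.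

Section Sharing.
Variable V : finType.
Implicit Types (cl sh s t : groups V) (A B S : {set V}).

Lemma downP cl A :
  reflect (A != set0 /\ exists2 C, C \in cl & A \subset C) (A \in down cl).
Proof.
apply: (iffP bigcupP) => [[C Ccl]|[An0 [C Ccl AC]]].
  by rewrite inE powersetE => /andP[AC An0]; split=> //; exists C.
by exists C; rewrite // inE powersetE AC.
Qed.

Lemma starP s A :
  reflect (exists t, [/\ t \subset s, t != set0 & A = cover t]) (A \in star s).
Proof.
apply: (iffP imsetP) => [[t]|[t [ts tn0 ->]]].
  by rewrite inE powersetE => /andP[ts tn0] ->; exists t.
by exists t; rewrite // inE powersetE ts.
Qed.

Lemma cover_star s t : t \subset s -> t != set0 -> cover t \in star s.
Proof. by move=> ts tn0; apply/starP; exists t. Qed.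

Lemma rel_vars_neq0 s S A : A \in rel_vars s S -> A != set0.
Proof. by rewrite inE => /andP[_]; apply: contraNneq => ->; rewrite set0I. Qed.

Lemma set0_notin_star_rel s S : set0 \notin star (rel_vars s S).
Proof.
apply/starP => -[t [ts /set0Pn[A At] t0]].
have/set0Pn[x xA] := rel_vars_neq0 (subsetP ts _ At).
have : x \in cover t by apply/bigcupP; exists A.
by rewrite -t0 inE.
Qed.

(** [is_normalize] constrains [normalize] only on [is_SHw] pairs, so this must be known of the pair
    that [extend_s] passes to it. *)
Lemma star_rel_is_SHw cl sh S :
  let clS := star (rel_vars cl S) in
  let shS := star (rel_vars sh S) in
  is_SHw (clS :|: bin_union clS shS, shS).
Proof.
split=> /=; last exact: set0_notin_star_rel.
rewrite inE negb_or set0_notin_star_rel; apply/imset2P => -[A B AclS _ /esym/eqP].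
rewrite setU_eq0 => /andP[/eqP A0 _].
by move: AclS; rewrite A0; apply/negP/set0_notin_star_rel.
Qed.

(** Enlarging a group that meets [S] to a clique above it keeps it relevant, so the union of such
    cliques lies in the star and bounds the union of the groups. *)
Lemma cover_down cl s S :
  s \subset rel_vars (down cl) S -> s != set0 ->
  exists2 B, B \in star (rel_vars cl S) & cover s \subset B.
Proof.
move=> /subsetP sdown /set0Pn[A As].
(* Taking every relevant clique above some member of [s] avoids choosing one for each member. *)
pose t := [set C in rel_vars cl S | [exists A in s, A \subset C]].
have above D : D \in s -> exists2 C, C \in t & D \subset C.
  move=> Ds; have := sdown _ Ds; rewrite inE => /andP[/downP[_ [C Ccl DC]] DS].
  exists C => //; rewrite !inE Ccl /=; apply/andP; split.
    by apply: contraNneq DS => CS; rewrite -subset0 -CS setSI.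
  by apply/existsP; exists D; rewrite Ds.
exists (cover t).
  apply: cover_star; first by apply/subsetP => C; rewrite inE => /andP[].
  by have [C Ct _] := above _ As; apply/set0Pn; exists C.
apply/bigcupsP => D Ds; have [C Ct DC] := above _ Ds.
by apply: (subset_trans DC); apply: (bigcup_sup C).
Qed.

(** A generating family splits into its members in [sh] and the rest, which lie below cliques. If
    the rest is empty, the union is in [shS]; otherwise it lies below a member of [clS] or, when
    both parts occur, of the [bin_union]. *)
Lemma star_rel_denot cl sh S :
  let clS := star (rel_vars cl S) in
  let shS := star (rel_vars sh S) in
  star (rel_vars (denot (cl, sh)) S)
    \subset denot (clS :|: bin_union clS shS, shS).
Proof.
apply/subsetP => A Astar.
have An0 : A != set0.
  by apply: contraTneq Astar => ->; apply: set0_notin_star_rel.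
case/starP: Astar => t [/subsetP tsub tn0 defA].
have shsub : t :&: sh \subset rel_vars sh S.
  apply/subsetP => B; rewrite inE => /andP[/tsub + Bsh].
  by rewrite !inE Bsh => /andP[].
(* A group represented in both ways is counted with [sh], so what remains is entirely in
   [down cl]. *)
have clsub : t :\: sh \subset rel_vars (down cl) S.
  apply/subsetP => B; rewrite inE => /andP[Bsh /tsub].
  by rewrite !inE (negPf Bsh) orbF.
have defA' : A = cover (t :\: sh) :|: cover (t :&: sh).
  by rewrite defA -{1}(setID t sh) setUC /cover bigcup_setU.
rewrite inE /=; have [tcl0|tcl] := eqVneq (t :\: sh) set0.
  have tsh : t :&: sh = t by apply/setIidPl; rewrite -setD_eq0 tcl0.
  by rewrite tsh in shsub; rewrite defA cover_star ?orbT.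
apply/orP; left; apply/downP; split=> //.
have [B BclS tB] := cover_down clsub tcl.
have [tsh0|tsh] := eqVneq (t :&: sh) set0.
  exists B; first by rewrite inE BclS.
  by rewrite defA' tsh0 /cover big_set0 setU0.
exists (B :|: cover (t :&: sh)); last by rewrite defA' setSU.
by rewrite inE; apply/orP; right; apply: imset2_f => //; apply: cover_star.
Qed.

(** A clique above a group containing [x] contains [x] too, so whole cliques bound the variables
    sharing with [x]. *)
Lemma cover_rel_var_denot cl sh s x :
  s \subset denot (cl, sh) ->
  cover (rel_var s x) \subset cover (rel_var sh x :|: rel_var cl x).
Proof.
move=> /subsetP ssub; apply/bigcupsP => A; rewrite inE => /andP[/ssub As xA].
move: As; rewrite inE => /orP[/downP[_ [C Ccl AC]]|Ash].
  apply: (subset_trans AC); apply: (bigcup_sup C) => //.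
  by rewrite !inE Ccl (subsetP AC) ?orbT.
by apply: (bigcup_sup A); rewrite // !inE Ash xA.
Qed.

Lemma extend_s_sound (F : Type) normalize (g : term F V) cl1 sh1 cl2 sh2 :
  is_normalize normalize ->
  extend (denot (cl1, sh1)) g (denot (cl2, sh2))
    \subset denot (extend_s normalize (cl1, sh1) g (cl2, sh2)).
Proof.
move=> Hnorm; have [_ _] := Hnorm _ (star_rel_is_SHw cl1 sh1 (vars g)).
have := star_rel_denot cl1 sh1 (vars g); rewrite /extend_s /=.
case: (normalize _) => clo sho star_sub def_denot.
apply/subsetP => A; rewrite in_setU => /orP[|].
  (* A group irrelevant to [g] avoids [vars g], so it stays below its clique after [rel_bar] removes
     those variables. *)
  rewrite !inE => /andP[Airrel AD]; move: Airrel; rewrite AD /= negbK => /eqP AG.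
  case/orP: AD => [/downP[An0 [C Ccl AC]]|Ash]; last first.
    by rewrite Ash AG eqxx /= ?orbT.
  apply/orP; left; apply/downP; split=> //.
  have ACG : A \subset C :\: vars g by rewrite subsetD AC -setI_eq0 AG eqxx.
  exists (C :\: vars g) => //; rewrite !inE; apply/orP; left; apply/andP; split.
    by apply: contraNneq An0 => C0; rewrite -subset0 -C0.
  exact: imset_f.
rewrite inE => /andP[/(subsetP star_sub)]; rewrite -def_denot !inE.
move=> /orP[/downP[An0 [C Cclo AC]]|->] /orP[/downP[_ [D Dcl2 AD]]|AG] /=.
- apply/orP; left; apply/downP; split=> //.
  (* On [vars g] the group is bounded by both [C] and [D], elsewhere by [C] alone. *)
  exists (C :&: D :|: C :\: vars g).
    by rewrite inE; apply/orP; right; apply/imset2P; exists C D.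
  by rewrite -(setID A (vars g)) setUSS ?setSD // subsetI AD subIset ?AC.
- have -> : [exists c in clo, A \subset c] by apply/existsP; exists C; rewrite Cclo.
  by rewrite AG /= !orbT.
- have -> : [exists c in cl2, A :&: vars g \subset c].
    by apply/existsP; exists D; rewrite Dcl2.
  by rewrite !orbT.
- by rewrite AG !orbT.
Qed.

End Sharing.

Theorem theorem2 (F : Type) (V : finType)
  (normalize : groups V * groups V -> groups V * groups V)
  (Hnormalize : is_normalize normalize)
  (g : term F V)
  (cl1 sh1 : groups V) (f1 : {set V})
  (cl2 sh2 : groups V) (f2 : {set V})
  (HCall : is_SHw (cl1, sh1))
  (HPrime : is_SHw (cl2, sh2))
  (HPrime_g : forall A : {set V}, A \in cl2 :|: sh2 -> A \subset vars g)
  (Hf2_g : f2 \subset vars g)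
  (HPrime_norm : normalized (cl2, sh2))
  (cl' sh' : groups V) (f' : {set V})
  (Hextend_sf : extend_sf normalize ((cl1, sh1), f1) g ((cl2, sh2), f2)
                = ((cl', sh'), f'))
  (sh : groups V) (f : {set V})
  (Hextend_f : extend_f (down cl1 :|: sh1, f1) g (down cl2 :|: sh2, f2)
               = (sh, f)) :
  sh \subset down cl' :|: sh' /\ f' \subset f.
Proof.
move: Hextend_sf Hextend_f; rewrite /extend_sf /extend_f.
have := extend_s_sound g cl1 sh1 cl2 sh2 Hnormalize.
case: (extend_s _ _ _ _) => cl sh0 sound [<- <- <-] [<- <-].
split=> //; apply: setUS; apply/subsetP => x; rewrite !inE => /andP[-> /=].
by apply: subset_trans; apply: setSI; apply: cover_rel_var_denot.
Qed.
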